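(* Let $L$ be a finite lattice. Then $$|\mathrm{J}(L)|\geq|\mathrm{J}(\mathrm{Con}\, L)|+\alpha(\mathrm{J}(\mathrm{Con}\, L)).$$
   Context: For a finite lattice $L$, $\mathrm{J}(L)$ denotes the set of all (nonzero) join-irreducible elements of $L$, regarded as a poset under the ordering of $L$. $\mathrm{Con}\,L$ is the congruence lattice of $L$ (ordered by inclusion), which is a finite distributive lattice. For a finite poset $P$, a spike of $P$ is a pair $\langle p,q\rangle$ of elements of $P$ such that $q$ is a maximal element of $P$ and $q$ is the unique element of $P$ that covers $p$. Define $\partial P=\{q\in P : \langle p,q\rangle \text{ is a spike of } P \text{ for some } p\in P\}$, $\partial_{\mathrm u}P=\{q\in P : \langle p,q\rangle \text{ is a spike of } P \text{ for a unique } p\in P\}$, $\partial_{\mathrm m}P=\partial P\setminus\partial_{\mathrm u}P$, and $\alpha(P)=|\partial_{\mathrm u}P|+2|\partial_{\mathrm m}P|$. *)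

(* Defs.v *)
From HB Require Import structures.
From mathcomp Require Import all_boot all_order.

Set Implicit Arguments.
Unset Strict Implicit.
Unset Printing Implicit Defensive.

Import Order.TTheory.
Local Open Scope order_scope.

Definition join_irreducible d (L : finTBLatticeType d) (x : L) : bool :=
  (x != \bot) &&
  [forall a : L, forall b : L, (x == a `|` b) ==> (x == a) || (x == b)].

Definition JI d (L : finTBLatticeType d) := {x : L | join_irreducible x}.

HB.instance Definition _ d (L : finTBLatticeType d) := SubFinite.on (JI L).
HB.instance Definition _ d (L : finTBLatticeType d) :=
  [SubChoice_isSubPOrder of JI L by <: with d].

Section Congruences.
Variables (d : Order.disp_t) (L : finTBLatticeType d).
Implicit Types (t : {set L * L}) (x y z : L).

Definition congr_refl t := [forall x, (x, x) \in t].
Definition congr_sym t := [forall x, forall y, ((x, y) \in t) ==> ((y, x) \in t)].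
Definition congr_trans t :=
  [forall x, forall y, forall z,
     ((x, y) \in t) && ((y, z) \in t) ==> ((x, z) \in t)].
Definition congr_meet t :=
  [forall x1, forall y1, forall x2, forall y2,
     ((x1, y1) \in t) && ((x2, y2) \in t) ==> ((x1 `&` x2, y1 `&` y2) \in t)].
Definition congr_join t :=
  [forall x1, forall y1, forall x2, forall y2,
     ((x1, y1) \in t) && ((x2, y2) \in t) ==> ((x1 `|` x2, y1 `|` y2) \in t)].

Definition is_congr t :=
  [&& congr_refl t, congr_sym t, congr_trans t, congr_meet t & congr_join t].

Lemma is_congrP t :
  reflect [/\ forall x, (x, x) \in t,
              forall x y, (x, y) \in t -> (y, x) \in t,
              forall x y z, (x, y) \in t -> (y, z) \in t -> (x, z) \in t,
              forall x1 y1 x2 y2, (x1, y1) \in t -> (x2, y2) \in t ->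
                (x1 `&` x2, y1 `&` y2) \in t
            & forall x1 y1 x2 y2, (x1, y1) \in t -> (x2, y2) \in t ->
                (x1 `|` x2, y1 `|` y2) \in t]
          (is_congr t).
Proof.
apply: (iffP and5P) => -[rt st tt mt jt]; split.
- by move=> x; apply: (forallP rt).
- by move=> x y; apply/implyP; move/forallP/(_ x)/forallP: st.
- move=> x y z xy yz.
  by move/forallP/(_ x)/forallP/(_ y)/forallP/(_ z): tt; rewrite xy yz.
- move=> x1 y1 x2 y2 h1 h2.
  by move/forallP/(_ x1)/forallP/(_ y1)/forallP/(_ x2)/forallP/(_ y2): mt;
    rewrite h1 h2.
- move=> x1 y1 x2 y2 h1 h2.
  by move/forallP/(_ x1)/forallP/(_ y1)/forallP/(_ x2)/forallP/(_ y2): jt;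
    rewrite h1 h2.
- by apply/forallP.
- by do 2![apply/forallP=> ?]; apply/implyP/st.
- by do 3![apply/forallP=> ?]; apply/implyP=> /andP[]; apply: tt.
- by do 4![apply/forallP=> ?]; apply/implyP=> /andP[]; apply: mt.
- by do 4![apply/forallP=> ?]; apply/implyP=> /andP[]; apply: jt.
Qed.

Record con := Con { con_set :> {set L * L}; con_congr : is_congr con_set }.

HB.instance Definition _ := [isSub for con_set].
HB.instance Definition _ := [Finite of con by <:].

Implicit Types (u v w : con).

Fact is_congr_bot : is_congr [set p | p.1 == p.2].
Proof.
apply/is_congrP; split=> [x|x y|x y z|x1 y1 x2 y2|x1 y1 x2 y2];
  rewrite !inE //=.
- by rewrite eq_sym.
- by move=> /eqP->.
- by move=> /eqP-> /eqP->.
- by move=> /eqP-> /eqP->.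
Qed.

Fact is_congr_top : is_congr setT.
Proof. by apply/is_congrP; split=> *; rewrite inE. Qed.

Fact is_congr_bigcap (Q : pred con) : is_congr (\bigcap_(u | Q u) con_set u).
Proof.
apply/is_congrP; split.
- by move=> x; apply/bigcapP=> u _; case/is_congrP: (con_congr u).
- move=> x y /bigcapP h; apply/bigcapP=> u Qu.
  by case/is_congrP: (con_congr u) => _ s _ _ _; apply/s/h.
- move=> x y z /bigcapP h1 /bigcapP h2; apply/bigcapP=> u Qu.
  by case/is_congrP: (con_congr u) => _ _ t _ _; apply: t (h1 u Qu) (h2 u Qu).
- move=> x1 y1 x2 y2 /bigcapP h1 /bigcapP h2; apply/bigcapP=> u Qu.
  by case/is_congrP: (con_congr u) => _ _ _ m _; apply: m (h1 u Qu) (h2 u Qu).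
- move=> x1 y1 x2 y2 /bigcapP h1 /bigcapP h2; apply/bigcapP=> u Qu.
  by case/is_congrP: (con_congr u) => _ _ _ _ j; apply: j (h1 u Qu) (h2 u Qu).
Qed.

Definition con_le : rel con := fun u v => con_set u \subset con_set v.
Definition con_bigcap (Q : pred con) := Con (is_congr_bigcap Q).
Definition con_meet u v := con_bigcap (pred2 u v).
Definition con_join u v := con_bigcap [pred w | con_le u w && con_le v w].

Fact con_le_refl : reflexive con_le.
Proof. by move=> u; apply: subxx. Qed.
Fact con_le_anti : antisymmetric con_le.
Proof. by move=> u v uv; apply/val_inj/eqP; rewrite eqEsubset. Qed.
Fact con_le_trans : transitive con_le.
Proof. by move=> v u w; apply: subset_trans. Qed.

Fact con_display : Order.disp_t. Proof. exact: Order.Disp tt tt. Qed.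

HB.instance Definition _ :=
  Order.Le_isPOrder.Build con_display con con_le_refl con_le_anti con_le_trans.

Fact con_meetP u v w : (u <= con_meet v w) = (u <= v) && (u <= w).
Proof.
apply/bigcapsP/andP=> [h|[uv uw] t /pred2P[]-> //].
by split; apply: h; rewrite /= eqxx ?orbT.
Qed.

Fact con_joinP u v w : (con_join u v <= w) = (u <= w) && (v <= w).
Proof.
apply/idP/andP=> [h|[uw vw]]; last first.
  by apply: (@bigcap_inf _ _ w); rewrite /= [con_le u w]uw [con_le v w]vw.
by split; apply: le_trans h; apply/bigcapsP=> t /andP[].
Qed.

HB.instance Definition _ :=
  Order.POrder_MeetJoin_isLattice.Build con_display con con_meetP con_joinP.

Fact con_le0x u : Con is_congr_bot <= u.
Proof.
apply/subsetP=> -[x y]; rewrite inE /= => /eqP->.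
by case/is_congrP: (con_congr u).
Qed.

Fact con_lex1 u : u <= Con is_congr_top.
Proof. exact: subsetT. Qed.

HB.instance Definition _ := Order.hasBottom.Build con_display con con_le0x.
HB.instance Definition _ := Order.hasTop.Build con_display con con_lex1.

End Congruences.

Section Spikes.
Variables (d : Order.disp_t) (P : finPOrderType d).
Implicit Types p q r : P.

Definition maximal q := [forall r, ~~ (q < r)].

Definition covered_by p q := (p < q) && [forall r, ~~ (p < r < q)].

Definition spike p q :=
  [&& maximal q, covered_by p q & [forall r, covered_by p r ==> (r == q)]].

(* The sets usually written \partial P, \partial_u P and \partial_m P. *)
Definition spike_tops : {set P} := [set q | [exists p, spike p q]].

Definition spike_tops_u : {set P} :=
  [set q | [exists p, spike p q && [forall r, spike r q ==> (r == p)]]].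

Definition spike_tops_m : {set P} := spike_tops :\: spike_tops_u.

Definition alpha : nat := (#|spike_tops_u| + 2 * #|spike_tops_m|)%N.

End Spikes.

Arguments con {d} L.
Arguments alpha {d} P.

(* Main.v *)
Require Import Defs.
From HB Require Import structures.
From mathcomp Require Import all_boot all_order.
Set Implicit Arguments.
Unset Strict Implicit.
Unset Printing Implicit Defensive.
Import Order.TTheory.
Local Open Scope order_scope.

(**
For a join-irreducible [a] of [L] with lower cover [low a], let [ji_con a] be
the congruence generated by [(low a, a)].  It is join-irreducible in [con L]
([ji_con_join_irreducible]), and every join-irreducible congruence has this
form ([ji_con_surj]), so [ji_map : JI L -> JI (con L)] is onto.  The theorem
measures how far this map is from being injective.

The key fact ([ji_con_not_unique]) is that the number of join-irreducibles
[c != a] with [ji_con a <= ji_con c] is never exactly one.  If [a] is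
join-prime, the relation identifying [u] and [v] when [a <= u] and [a <= v]
are equivalent is a congruence that collapses [(low c, c)] for every [c != a]
but not [(low a, a)], so there is no such [c].  Otherwise [a <= x `|` z] with
[a] below neither [x] nor [z]; this cover refines to a minimal one by
join-irreducibles [c], each below [x] or [z], and minimality forces
[ji_con a <= ji_con c] ([tight_cover]).  Such a cover avoids [a] and has at
least two elements.

Write [N p] for the size of the fiber of [ji_map] over [p] and [N p - 1] for
its excess.  When [q] is maximal, the key fact applied to an element of the
fiber over [q] gives [N q != 2].  When [p, q] is a spike, the only elements
above [p] are [p] and [q], so the key fact gives [N p + N q != 2].  Hence for
a spike top [q], either the excess at [q] is at least 2, or it is 0 and every
[p] forming a spike with [q] has excess at least 1.  Each [p] belongs to a
single spike top, so these contributions add up to at least [alpha]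
([card_add_alpha_le]).
*)

(** * Join-irreducible elements of a finite lattice *)

Section Lattice.
Variables (d : Order.disp_t) (L : finTBLatticeType d).
Implicit Types (a b c u v w x y z : L) (t : con L).

(** The join of all elements strictly below [a]; it is the unique lower cover
    of [a] when [a] is join-irreducible. *)
Definition low a : L := \join_(x | x < a) x.

Lemma lt_low x a : x < a -> x <= low a.
Proof. by move=> xa; apply: (@joins_sup _ _ _ x _ id). Qed.

Lemma low_le a : low a <= a.
Proof. by apply/joinsP => x /ltW. Qed.

Lemma join_irreducible_lt a x y :
  join_irreducible a -> x < a -> y < a -> x `|` y < a.
Proof.
case/andP=> _ /forallP/(_ x)/forallP/(_ y)/implyP irr xa ya.
rewrite lt_neqAle leUx (ltW xa) (ltW ya) !andbT eq_sym; apply/negP => /irr.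
by case/orP=> /eqP E; [move: xa | move: ya]; rewrite -E ltxx.
Qed.

Lemma low_lt a : join_irreducible a -> low a < a.
Proof.
move=> ja; rewrite /low; elim/big_ind: _ => //.
- by case/andP: ja => a0 _; rewrite lt0x.
- by move=> x y; apply: join_irreducible_lt.
Qed.

Lemma nle_low a x : ~~ (a <= x) -> a `&` x <= low a.
Proof.
move=> nax; apply: lt_low; rewrite lt_neqAle leIl andbT.
by apply: contraNneq nax => <-; rewrite leIr.
Qed.

Lemma lt_finind (P : L -> Prop) :
  (forall a, (forall x, x < a -> P x) -> P a) -> forall a, P a.
Proof.
move=> IH a; have [n] := ubnP #|[set x | x < a]|.
elim: n a => // n IHn a; rewrite ltnS => le_n; apply: IH => x xa; apply: IHn.
apply: leq_trans le_n; apply: proper_card; apply/properP; split.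
  by apply/subsetP => y; rewrite !inE => /lt_trans; apply.
by exists x; rewrite inE // ltxx.
Qed.

Lemma join_reducibleP a :
  ~~ join_irreducible a ->
  a = \bot \/ exists x y, [/\ x < a, y < a & a = x `|` y].
Proof.
rewrite negb_and negbK => /orP[/eqP->|]; first by left.
case/forallPn => x /forallPn[y]; rewrite negb_imply negb_or.
case/and3P=> /eqP E nx ny; right; exists x, y; split=> //.
  by rewrite lt_neqAle eq_sym nx E leUl.
by rewrite lt_neqAle eq_sym ny E leUr.
Qed.

Lemma join_JI_le a : a <= \join_(x | join_irreducible x && (x <= a)) x.
Proof.
elim/lt_finind: a => a IH.
have mono x : x <= a -> \join_(y | join_irreducible y && (y <= x)) y
    <= \join_(y | join_irreducible y && (y <= a)) y.
  move=> xa; apply/joinsP => y /andP[jy yx].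
  by apply: (@joins_sup _ _ _ y _ id); rewrite jy (le_trans yx).
have [ja|/join_reducibleP] := boolP (join_irreducible a).
  by apply: (@joins_sup _ _ _ a _ id); rewrite ja /=.
case=> [->|[x [y [xa ya E]]]]; first exact: le0x.
rewrite {1}E leUx; apply/andP; split.
  exact: le_trans (IH _ xa) (mono _ (ltW xa)).
exact: le_trans (IH _ ya) (mono _ (ltW ya)).
Qed.

(** * Congruences generated by join-irreducible elements *)

Lemma con_refl t x : (x, x) \in con_set t.
Proof. by case/is_congrP: (con_congr t). Qed.
Lemma con_sym t x y : (x, y) \in con_set t -> (y, x) \in con_set t.
Proof. by case/is_congrP: (con_congr t) => _ + _ _ _; apply. Qed.
Lemma con_trans t x y z :
  (x, y) \in con_set t -> (y, z) \in con_set t -> (x, z) \in con_set t.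
Proof. by case/is_congrP: (con_congr t) => _ _ + _ _; apply. Qed.
Lemma con_meetl t z x y :
  (x, y) \in con_set t -> (z `&` x, z `&` y) \in con_set t.
Proof.
by case/is_congrP: (con_congr t) => _ _ _ + _; apply => //; apply: con_refl.
Qed.
Lemma con_joinl t z x y :
  (x, y) \in con_set t -> (z `|` x, z `|` y) \in con_set t.
Proof.
by case/is_congrP: (con_congr t) => _ _ _ _; apply => //; apply: con_refl.
Qed.
Lemma con_joinD t x1 y1 x2 y2 :
  (x1, y1) \in con_set t -> (x2, y2) \in con_set t ->
  (x1 `|` x2, y1 `|` y2) \in con_set t.
Proof. by case/is_congrP: (con_congr t) => _ _ _ _; apply. Qed.

Lemma con_convex t x y z :
  x <= y -> y <= z -> (x, z) \in con_set t -> (y, z) \in con_set t.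
Proof.
move=> xy yz /(con_joinl y); rewrite (join_idPl xy).
by rewrite joinC (join_idPl yz).
Qed.

(** The least congruence identifying [a] with [low a]. *)
Definition ji_con a : con L :=
  con_bigcap [pred t : con L | (low a, a) \in con_set t].

Lemma ji_con_le a t : (ji_con a <= t) = ((low a, a) \in con_set t).
Proof.
apply/idP/idP=> [/subsetP|at_]; last exact: bigcap_inf.
by apply; apply/bigcapP.
Qed.

(** A congruence is determined by the join-irreducibles [a] that it identifies
    with [low a]. *)
Lemma con_sub_ji t t' :
  (forall a, join_irreducible a -> (low a, a) \in con_set t ->
     (low a, a) \in con_set t') -> t <= t'.
Proof.
move=> sub; suff meet_in u v : (u, v) \in con_set t ->
    (u `&` v, u) \in con_set t'.
  apply/subsetP => -[u v] uv; apply: (@con_trans _ _ (u `&` v)).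
    exact/con_sym/meet_in.
  by rewrite meetC; apply/meet_in/con_sym.
move=> uv.
(* Induction on [e]: a join-irreducible [e] not below [v] descends to [low e],
   and any other [e] splits as a join of two smaller elements. *)
suff: forall e, e <= u -> (e `&` v, e) \in con_set t' by apply.
elim/lt_finind => e IH eu.
have [ev|nev] := boolP (e <= v); first by rewrite (meet_idPl ev) con_refl.
have [je|/join_reducibleP] := boolP (join_irreducible e); last first.
  case=> [e0|[x [y [xe ye E]]]]; first by rewrite e0 le0x in nev.
  have xu := le_trans (ltW xe) eu; have yu := le_trans (ltW ye) eu.
  have := con_joinD (IH x xe xu) (IH y ye yu); rewrite -E.
  by apply: con_convex; rewrite ?leIl // leUx !leI2 // ltW.
have evl := nle_low nev.
have lt_e : (low e, e) \in con_set t.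
  apply: con_convex evl (low_le e) _; have := con_meetl e (con_sym uv).
  by rewrite (meet_idPl eu).
apply: con_trans (sub _ je lt_e).
have := IH _ (low_lt je) (le_trans (low_le e) eu).
suff -> : low e `&` v = e `&` v by [].
by apply/le_anti; rewrite leI2 ?low_le //= lexI evl leIr.
Qed.

(** A two-element join cover of a join-irreducible [a] refines to a cover by
    join-irreducibles [c] such that collapsing [c] to [low c] collapses [a] to
    [low a]. *)
Lemma tight_cover a x z :
  join_irreducible a -> a <= x `|` z ->
  exists C : {set L},
    [/\ a <= \join_(c in C) c,
        forall c, c \in C -> join_irreducible c,
        forall c, c \in C -> (c <= x) || (c <= z)
      & forall c, c \in C -> ji_con a <= ji_con c].
Proof.
move=> ja axz.
pose P (E : {set L}) := [&& a <= \join_(c in E) c,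
  [forall c in E, join_irreducible c] &
  [forall c in E, forall b, join_irreducible b && (b <= c) ==> (b \in E)]].
pose E0 := [set c | join_irreducible c && ((c <= x) || (c <= z))].
have PE0 : P E0.
  apply/and3P; split.
  - apply: le_trans axz _.
    rewrite leUx; apply/andP; split; (apply: le_trans (join_JI_le _) _);
      apply/joinsP => c /andP[jc cx]; apply: (@joins_sup _ _ _ c _ id);
      by rewrite inE jc cx ?orbT.
  - by apply/forall_inP => c; rewrite inE => /andP[].
  - apply/forall_inP => c; rewrite inE => /andP[_ cxz].
    apply/forallP => b; apply/implyP => /andP[jb bc]; rewrite inE jb /=.
    by case/orP: cxz => h; rewrite (le_trans bc h) ?orbT.
(* [E] is an inclusion-minimal set of join-irreducibles that is downward closed
   among them and joins above [a]; the cover [C] is its set of maximal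
   elements. *)
have [E /minsetP[PE minE] sEE0] := minset_exists PE0.
case/and3P: PE => aE /forall_inP jE /forall_inP dE.
pose C := [set c in E | [forall b in E, ~~ (c < b)]].
have sCE : C \subset E by apply/subsetP => c; rewrite inE => /andP[].
exists C; split.
- apply: le_trans aE _; apply/joinsP => c.
  have [n] := ubnP #|[set y | c < y]|; elim: n c => // n IHn c.
  rewrite ltnS => le_n cE.
  have [cC|] := boolP (c \in C); first exact: (@joins_sup _ _ _ c _ id).
  rewrite inE cE /= => /forall_inPn[b bE]; rewrite negbK => cb.
  apply: le_trans (ltW cb) (IHn b _ bE).
  apply: leq_trans le_n; apply: proper_card; apply/properP; split.
    by apply/subsetP => y; rewrite !inE; apply: lt_trans.
  by exists b; rewrite inE // ltxx.
- by move=> c /(subsetP sCE) /jE.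
- by move=> c /(subsetP sCE) /(subsetP sEE0); rewrite inE => /andP[].
- move=> c; rewrite inE => /andP[cE /forall_inP cmax].
  set r := \join_(b in E :\ c) b.
  (* By minimality of [E], the rest [r] no longer covers [a], whereas it lies
     above [low c]; modulo [ji_con c], joining [c] to [r] changes nothing. *)
  have nar : ~~ (a <= r).
    apply/negP => ar; have PE' : P (E :\ c).
      apply/and3P; split=> //.
        by apply/forall_inP => b /setD1P[_ /jE].
      apply/forall_inP => b /setD1P[bc bE]; apply/forallP => e.
      apply/implyP => /andP[je eb]; have /forallP/(_ e) := dE _ bE.
      rewrite je eb /= => eE; rewrite in_setD1 eE andbT.
      apply/eqP => ec; have := cmax _ bE; rewrite lt_neqAle -{2}ec eb.
      by rewrite eq_sym bc.
    by have /setP/(_ c) := minE _ PE' (subsetDl _ _); rewrite !inE cE eqxx.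
  have lcr : low c <= r.
    apply: le_trans (join_JI_le _) _; apply/joinsP => b /andP[jb blc].
    apply: (@joins_sup _ _ _ b _ id); rewrite in_setD1.
    have bltc : b < c := le_lt_trans blc (low_lt (jE _ cE)).
    rewrite (lt_eqF bltc) /=.
    by have /forallP/(_ b) := dE _ cE; rewrite jb (ltW bltc).
  have arc : a <= r `|` c.
    by apply: le_trans aE _; rewrite (big_setD1 c) //= joinC.
  rewrite ji_con_le.
  have : (low c, c) \in con_set (ji_con c) by rewrite -ji_con_le.
  move=> /(con_joinl r)/(con_meetl a).
  rewrite (join_idPl lcr) (meet_idPl arc).
  by apply: con_convex (low_le a); apply: nle_low.
Qed.

(** The pairs of elements that have the same members of [U] below them. *)
Definition sep_rel (U : {set L}) : {set L * L} :=
  [set p | [forall b in U, (b <= p.1) == (b <= p.2)]].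

Lemma sep_relP (U : {set L}) x y :
  reflect (forall b, b \in U -> (b <= x) = (b <= y)) ((x, y) \in sep_rel U).
Proof. by rewrite inE; apply: (iffP forall_inP) => h b /h /eqP. Qed.

(** [sep_rel U] is a congruence as soon as each two-element join cover of a
    member of [U] refines to a cover by members of [U]. *)
Lemma sep_congr (U : {set L}) :
  (forall b x z, b \in U -> b <= x `|` z ->
     b <= \join_(c in U | (c <= x) || (c <= z)) c) ->
  is_congr (sep_rel U).
Proof.
move=> dec; apply/is_congrP; split.
- by move=> x; apply/sep_relP.
- by move=> x y /sep_relP h; apply/sep_relP => b /h.
- move=> x y z /sep_relP h1 /sep_relP h2; apply/sep_relP => b bU.
  by rewrite h1 // h2.
- move=> x1 y1 x2 y2 /sep_relP h1 /sep_relP h2; apply/sep_relP => b bU.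
  by rewrite !lexI h1 // h2.
- move=> x1 y1 x2 y2 /sep_relP h1 /sep_relP h2; apply/sep_relP => b bU.
  apply/idP/idP => /(dec _ _ _ bU) /le_trans; apply; apply/joinsP => c;
    case/andP=> cU; [rewrite h1 // h2 // | rewrite -h1 // -h2 //];
    by case/orP => /le_trans; apply; rewrite ?leUl ?leUr.
Qed.

(** If neither [t1] nor [t2] collapses [a] to [low a], neither does their join:
    [sep_rel] of the set of join-irreducibles collapsed by neither [t1] nor [t2]
    is a congruence containing both. *)
Lemma ji_con_join_prime a t1 t2 : join_irreducible a ->
  ji_con a <= t1 `|` t2 -> (ji_con a <= t1) || (ji_con a <= t2).
Proof.
move=> ja; apply: contraTT; rewrite negb_or => na.
pose U := [set b | [&& join_irreducible b, ~~ (ji_con b <= t1)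
                     & ~~ (ji_con b <= t2)]].
have dec b x z : b \in U -> b <= x `|` z ->
     b <= \join_(c in U | (c <= x) || (c <= z)) c.
  rewrite inE => /and3P[jb nb1 nb2] /(tight_cover jb)[C [bC jC Cxz Ccon]].
  apply: le_trans bC _; apply/joinsP => c cC.
  apply: (@joins_sup _ _ _ c _ id); rewrite inE Cxz // jC //= andbT.
  by rewrite (contra (le_trans (Ccon c cC)) nb1)
             (contra (le_trans (Ccon c cC)) nb2).
have sub t : (forall b, b \in U -> ~~ (ji_con b <= t)) ->
    t <= Con (sep_congr dec).
  move=> nUt; apply/subsetP => -[u v] uv; apply/sep_relP => b bU.
  have half x y : (x, y) \in con_set t -> b <= x -> b <= y.
    move=> xy bx; apply/negPn/negP => nby; have := nUt b bU.
    rewrite ji_con_le; apply/negP/negPn; apply: con_convex (nle_low nby) _ _.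
      exact: low_le.
    by have := con_meetl b (con_sym xy); rewrite (meet_idPl bx).
  by apply/idP/idP; apply: half; rewrite // con_sym.
have le12 : t1 `|` t2 <= Con (sep_congr dec).
  by rewrite leUx !sub // => b; rewrite inE => /and3P[].
apply/negP => /le_trans/(_ le12); rewrite ji_con_le => /sep_relP/(_ a).
rewrite lexx inE ja na => /(_ isT) ala.
by have := le_lt_trans ala (low_lt ja); rewrite ltxx.
Qed.

Lemma ji_con_join_irreducible a :
  join_irreducible a -> join_irreducible (ji_con a).
Proof.
move=> ja; apply/andP; split.
  apply/eqP => E; have : ji_con a <= \bot by rewrite E.
  by rewrite ji_con_le inE /= (lt_eqF (low_lt ja)).
apply/forallP => t1; apply/forallP => t2; apply/implyP => /eqP E.
have : ji_con a <= t1 `|` t2 by rewrite -E.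
by case/(ji_con_join_prime ja)/orP=> le_a; apply/orP; [left|right]; rewrite eq_le le_a E ?leUl ?leUr.
Qed.

(** The key fact: one join-irreducible [b != a] with [ji_con a <= ji_con b]
    entails two of them. *)
Lemma ji_con_not_unique a b :
  join_irreducible a -> join_irreducible b -> b != a ->
  ji_con a <= ji_con b ->
  exists c1 c2, [/\ c1 != c2, join_irreducible c1 && (c1 != a),
    join_irreducible c2 && (c2 != a), ji_con a <= ji_con c1
    & ji_con a <= ji_con c2].
Proof.
move=> ja jb nba le_ab.
have [/existsP[x /existsP[z /and3P[axz nax naz]]]|prime_a] :=
  boolP [exists x, exists z, [&& a <= x `|` z, ~~ (a <= x) & ~~ (a <= z)]].
  have [C [aC jC Cxz Ccon]] := tight_cover ja axz.
  have nle c : c \in C -> ~~ (a <= c).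
    by move/Cxz => /orP[] h; [apply: contra nax | apply: contra naz];
       move/le_trans; apply.
  have nea c : c \in C -> c != a.
    by move=> cC; apply: contraNneq (nle c cC) => ->.
  have [C0|[c1 c1C]] := set_0Vmem C.
    move: aC; rewrite C0 big_set0 lex0.
    by case/andP: ja => /negPf->.
  have /forall_inPn[c2 c2C nc21] : ~~ [forall c in C, c <= c1].
    apply: contra (nle _ c1C) => /forall_inP h.
    by apply: le_trans aC _; apply/joinsP.
  exists c1, c2; rewrite !jC ?nea ?Ccon //; split=> //.
  by apply: contraNneq nc21 => ->.
(* From here on [a] is join-prime, which makes [sep_rel [set a]] a
   congruence. *)
have dec e x z : e \in [set a] -> e <= x `|` z ->
     e <= \join_(c in [set a] | (c <= x) || (c <= z)) c.
  move=> /set1P-> axz; apply: (@joins_sup _ _ _ a _ id); rewrite set11 /=.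
  apply: contraNT prime_a; rewrite negb_or => /andP[nax naz].
  by apply/existsP; exists x; apply/existsP; exists z; rewrite axz nax.
have le_b : ji_con b <= Con (sep_congr dec).
  rewrite ji_con_le; apply/sep_relP => e /set1P->; apply/idP/idP.
    by move/le_trans; apply; apply: low_le.
  by move=> ab; apply: lt_low; rewrite lt_neqAle ab eq_sym nba.
have := le_trans le_ab le_b; rewrite ji_con_le => /sep_relP/(_ a (set11 a)).
rewrite lexx => ala.
by have := le_lt_trans ala (low_lt ja); rewrite ltxx.
Qed.

End Lattice.

Lemma ji_con_surj d (L : finTBLatticeType d) (t : con L) :
  join_irreducible t -> exists2 a : L, join_irreducible a & ji_con a = t.
Proof.
move=> jt; have [/exists_inP[a ja /eqP]|none] :=
  boolP [exists a in @join_irreducible d L, ji_con a == t]; first by exists a.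
have : t <= low t.
  apply: con_sub_ji => a ja; rewrite -!ji_con_le => at_; apply: lt_low.
  rewrite lt_neqAle at_ andbT; apply: contra none => E.
  by apply/exists_inP; exists a.
by move/le_lt_trans/(_ (low_lt jt)); rewrite ltxx.
Qed.

(** * Counting fibers over spikes *)

Section Counting.
Variables (d : Order.disp_t) (P : finPOrderType d) (T : finType) (f : T -> P).
Implicit Types (p q r : P) (a c : T).

Lemma exists_cover p r : p < r -> exists2 s, covered_by p s & s <= r.
Proof.
have [n] := ubnP #|[set x | x < r]|; elim: n r => // n IHn r.
rewrite ltnS => le_n pr.
have [cov|] := boolP (covered_by p r); first by exists r.
rewrite /covered_by pr => /forallPn[s]; rewrite negbK => /andP[ps sr].
have [|s' cov s's] := IHn s _ ps; last first.
  by exists s' => //; apply: le_trans s's (ltW sr).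
apply: leq_trans le_n; apply: proper_card; apply/properP; split.
  by apply/subsetP => y; rewrite !inE => /lt_trans; apply.
by exists s; rewrite inE // ltxx.
Qed.

Lemma maximal_le q r : maximal q -> (q <= r) = (r == q).
Proof.
move=> /forallP/(_ r) mq; rewrite le_eqVlt (negPf mq) orbF.
exact: eq_sym.
Qed.

(** The elements above the bottom [p] of a spike are just [p] and [q]. *)
Lemma spike_le p q r : spike p q -> (p <= r) = (r == p) || (r == q).
Proof.
case/and3P=> mq /andP[pq _] /forallP uniq_q; apply/idP/idP.
  rewrite le_eqVlt => /orP[/eqP->|/exists_cover[s cov sr]]; first by rewrite eqxx.
  have := uniq_q s; rewrite cov => /eqP sq; rewrite sq in sr.
  by rewrite -(maximal_le r mq) sr orbT.
by case/orP=> /eqP-> //; apply: ltW.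
Qed.

Lemma spike_lt p q : spike p q -> p < q.
Proof. by case/and3P=> _ /andP[]. Qed.

Lemma spike_uniq p q q' : spike p q -> spike p q' -> q = q'.
Proof.
by case/and3P=> _ cov _ /and3P[_ _ /forallP/(_ q)]; rewrite cov => /eqP.
Qed.

Hypothesis f_surj : forall p, exists a, f a = p.
Hypothesis f_above : forall a, #|[set c | (c != a) && (f a <= f c)]| != 1%N.

Let fiber p := [set c | f c == p].
(** The number of elements of the fiber over [p] beyond the first. *)
Let excess p := #|fiber p|.-1.

Let card_fiber p : #|fiber p| = (excess p).+1.
Proof.
rewrite prednK //; apply/card_gt0P.
by have [a fa] := f_surj p; exists a; rewrite inE fa.
Qed.

Let excess_maximal q : maximal q -> excess q != 1%N.
Proof.
move=> mq; have [a fa] := f_surj q; have := f_above a.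
suff -> : #|[set c | (c != a) && (f a <= f c)]| = excess q by [].
have aq : a \in fiber q by rewrite inE fa.
rewrite /excess (cardsD1 a (fiber q)) aq add1n; apply: eq_card => c.
by rewrite !inE fa maximal_le.
Qed.

Let excess_spike p q : spike p q -> (0 < excess p + excess q)%N.
Proof.
move=> pq; have [a fa] := f_surj p.
have ap : a \in fiber p by rewrite inE fa.
have disj : fiber p :&: fiber q = set0.
  apply/setP => c; rewrite !inE; apply/andP => -[/eqP-> /eqP E].
  by have := spike_lt pq; rewrite E ltxx.
have := f_above a; rewrite -eqSS.
suff -> : #|[set c | (c != a) && (f a <= f c)]|.+1 = (#|fiber p| + #|fiber q|)%N.
  by rewrite !card_fiber addnS addSn !eqSS lt0n.
rewrite -cardsUI disj cards0 addn0 [RHS](cardsD1 a) inE ap add1n; congr _.+1.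
by apply: eq_card => c; rewrite !inE fa (spike_le _ pq).
Qed.

(** The spike top to which the excess of [p] is credited: [p] itself if it is a
    spike top, otherwise the top of the spike starting at [p].  The default
    value [p], when there is no such spike, is immaterial. *)
Let owner p := if p \in @spike_tops d P then p else odflt p [pick q | spike p q].

Let owner_top q : q \in @spike_tops d P -> owner q = q.
Proof. by rewrite /owner => ->. Qed.

Let owner_spike p q : spike p q -> owner p = q.
Proof.
move=> pq; rewrite /owner inE; case: ifP => [/existsP[r rp]|_].
  by have /and3P[/forallP/(_ q)] := rp; rewrite (spike_lt pq).
by case: pickP => [q' /(spike_uniq pq)|/(_ q)]; rewrite ?pq.
Qed.

Let owner_sum q :
  ((q \in @spike_tops_u d P) + 2 * (q \in @spike_tops_m d P)
    <= \sum_(p | owner p == q) excess p)%N.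
Proof.
rewrite in_setD.
have [qtop|nqtop] := boolP (q \in @spike_tops d P); last first.
  rewrite andbF muln0 addn0 inE; case: existsP => // -[p /andP[pq _]].
  by case/negP: nqtop; rewrite inE; apply/existsP; exists p.
rewrite (bigD1 q) ?owner_top //= andbT.
have /existsP[p pq] : [exists p, spike p q] by rewrite inE in qtop.
have neq r : spike r q -> (owner r == q) && (r != q).
  by move=> rq; rewrite (owner_spike rq) eqxx (lt_eqF (spike_lt rq)).
(* The excess at the maximal element [q] is not 1: either it is at least 2 and
   suffices alone, or it is 0 and every spike bottom below [q] contributes. *)
have := excess_maximal (proj1 (andP pq)).
have := @excess_spike^~ q.
case: (excess q) => [|[|n]] // es _; last by case: (q \in _); rewrite ?addSn.
rewrite add0n (bigD1 p) ?neq //=.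
have ep : (0 < excess p)%N by have := es _ pq; rewrite addn0.
case qu : (q \in _) => /=.
  by rewrite muln0 addn0 (leq_trans ep) ?leq_addr.
have /forallPn[r] : ~~ [forall r, spike r q ==> (r == p)].
  apply/negP => h; move/negP: qu; apply; rewrite inE; apply/existsP.
  by exists p; rewrite pq.
rewrite negb_imply => /andP[rq rp]; rewrite (bigD1 r) ?neq //= addnA.
have er : (0 < excess r)%N by have := es _ rq; rewrite addn0.
by apply: leq_trans (leq_addr _ _); rewrite (leq_add ep er).
Qed.

(** Here [f : T -> P] is any surjection such that no [a] has exactly one
    [c != a] with [f a <= f c]. *)
Lemma card_add_alpha_le : (#|P| + alpha P <= #|T|)%N.
Proof.
have -> : #|T| = (#|P| + \sum_p excess p)%N.
  rewrite -sum1_card (partition_big f predT) //= -sum1_card -big_split /=.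
  apply: eq_bigr => p _; rewrite add1n -card_fiber -sum1_card.
  by apply: eq_bigl => c; rewrite inE.
rewrite leq_add2l (partition_big owner predT) //= /alpha.
rewrite -!sum1_card big_distrr !(big_mkcond (fun q => q \in _)) -big_split /=.
apply: leq_sum => q _; apply: leq_trans (owner_sum q).
by case: (q \in _); case: (q \in _).
Qed.

End Counting.

(** * The map from join-irreducible elements to join-irreducible congruences *)

Section JIMap.
Variables (d : Order.disp_t) (L : finTBLatticeType d).

(** [ji_con] as a map between the posets of join-irreducibles. *)
Definition ji_map (a : JI L) : JI (con L) :=
  Sub (ji_con (val a)) (ji_con_join_irreducible (valP a)).

Lemma ji_map_surj t : exists a, ji_map a = t.
Proof.
have [a ja E] := ji_con_surj (valP t).
by exists (Sub a ja); apply: val_inj.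
Qed.

Lemma card_ji_map_above a :
  #|[set c | (c != a) && (ji_map a <= ji_map c)]| != 1%N.
Proof.
apply/negP => /cards1P[b E].
have /setP/(_ b) := E; rewrite !inE eqxx => /andP[nba le_ab].
have [c1 [c2 [n12 /andP[j1 n1] /andP[j2 n2] le1 le2]]] :=
  ji_con_not_unique (valP a) (valP b) nba le_ab.
have eqb c (jc : join_irreducible c) : c != val a ->
    ji_con (val a) <= ji_con c -> c = val b.
  move=> nc lec; have /setP/(_ (Sub c jc)) := E.
  by rewrite !inE -!val_eqE /= nc [ji_map a <= _]lec => /esym/eqP<-.
by case/eqP: n12; rewrite (eqb c1) // (eqb c2).
Qed.

End JIMap.

Theorem theorem5p2 (d : Order.disp_t) (L : finTBLatticeType d) :
  (#|{: JI L}| >= #|{: JI (con L)}| + alpha (JI (con L)))%N.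
Proof.
exact: card_add_alpha_le (@ji_map_surj d L) (@card_ji_map_above d L).
Qed.
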